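(* For positive integers $n$ and $m$ with $m\le n$, let $f(n,m)$ denote the number of forest chord diagrams with $n$ chords whose intersection graph has exactly $m$ connected components (trees). Then \[ f(n,m)=\begin{cases}\dfrac{1}{n-m}\dbinom{2n}{m-1}\dbinom{3n-2m-1}{n-m-1}, & \text{if } 1\le m\le n-1,\\[2ex] \dfrac{1}{n+1}\dbinom{2n}{n}, & \text{if } m=n.\end{cases} \]
   Context: A chord diagram of size $n$ is a perfect matching (pairing) of the $2n$ points labeled $1,\dots,2n$, placed in clockwise order on a circle; each pair is drawn as a chord. Two chord diagrams are the same exactly when they are the same pairing of $\{1,\dots,2n\}$. Two chords $\{a,c\}$ and $\{b,d\}$ with $a<c$, $b<d$ cross if $a<b<c<d$ or $b<a<d<c$. The intersection graph $G_{\mathcal C}$ of a chord diagram $\mathcal C$ has the chords of $\mathcal C$ as vertices, two vertices being adjacent iff the corresponding chords cross. $\mathcal C$ is a forest chord diagram if $G_{\mathcal C}$ is a forest (acyclic graph), and a tree chord diagram if $G_{\mathcal C}$ is a tree. *)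

(* Defs.v *)
From mathcomp Require Import all_boot.

Set Implicit Arguments.
Unset Strict Implicit.
Unset Printing Implicit Defensive.

(* The point labelled k + 1 is the ordinal k, so the labels 1, ..., 2n become  *)
(* 0, ..., 2n - 1 in the same order; a pairing is the set of its blocks.       *)
Definition chord_diagram (n : nat) (C : {set {set 'I_(2 * n)}}) : bool :=
  partition C [set: 'I_(2 * n)] && [forall A in C, #|A| == 2].

(* The inequalities imply the normalisation a < c and b < d.                   *)
Definition cross (N : nat) (A B : {set 'I_N}) : bool :=
  [exists a, exists b, exists c, exists d,
    [&& A == [set a; c], B == [set b; d]
      & [|| [&& a < b, b < c & c < d] | [&& b < a, a < d & d < c]]]].

(* Adjacency in the intersection graph, whose vertex set is C. The relation    *)
(* lives on all sets of points; sets that are not chords of C are isolated,    *)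
(* so they lie on no cycle, and components are counted inside C only.          *)
Definition intersection_graph (N : nat) (C : {set {set 'I_N}}) :
    rel {set 'I_N} :=
  [rel A B | [&& A \in C, B \in C & cross A B]].

(* A cycle of a simple graph is a closed walk through at least three vertices, *)
(* all distinct; lengths are bounded by #|T| only to get a boolean, see        *)
(* acyclicP.                                                                   *)
Definition acyclic (T : finType) (e : rel T) : bool :=
  [forall k : 'I_#|T|.+1, forall s : k.-tuple T, (2 < k) ==> ~~ ucycleb e s].

Lemma acyclicP (T : finType) (e : rel T) :
  reflect (forall s : seq T, ucycle e s -> size s <= 2) (acyclic e).
Proof.
apply: (iffP idP) => [/forallP acy s cyc | acy].
  rewrite leqNgt; apply/negP => s3.
  have sT : size s < #|T|.+1.
    by rewrite ltnS -(card_uniqP (proj2 (andP cyc))) max_card.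
  move/forallP/(_ (in_tuple s)): (acy (Ordinal sT)).
  by rewrite /= s3 /= (cyc : ucycleb e s).
apply/forallP => k; apply/forallP => s; apply/implyP => k3.
by apply/negP => /acy; rewrite size_tuple leqNgt k3.
Qed.

Definition forest_chord_diagram (n : nat) (C : {set {set 'I_(2 * n)}}) : bool :=
  chord_diagram C && acyclic (intersection_graph C).

Definition num_components (N : nat) (C : {set {set 'I_N}}) : nat :=
  n_comp (intersection_graph C) C.

Lemma cross_sym (N : nat) : symmetric (@cross N).
Proof.
suff H A B : @cross N A B -> cross B A by move=> A B; apply/idP/idP; apply: H.
case/existsP=> a /existsP[b /existsP[c /existsP[d /and3P[hA hB h]]]].
apply/existsP; exists b; apply/existsP; exists a.
apply/existsP; exists d; apply/existsP; exists c.
by rewrite hA hB orbC.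
Qed.

(* The side conditions under which n_comp counts connected components.         *)
Lemma intersection_graph_connect_sym (N : nat) (C : {set {set 'I_N}}) :
  connect_sym (intersection_graph C).
Proof.
by apply: sym_connect_sym => A B; apply/and3P/and3P => -[? ? ?];
  split=> //; rewrite cross_sym.
Qed.

Lemma intersection_graph_closed (N : nat) (C : {set {set 'I_N}}) :
  closed (intersection_graph C) C.
Proof. by move=> A B /and3P[-> ->]. Qed.

Definition num_forest_diagrams (n m : nat) : nat :=
  #|[set C : {set {set 'I_(2 * n)}} |
      forest_chord_diagram C && (num_components C == m)]|.

(* Main.v *)
(* Read the 2n points in increasing order, keeping the stack of open chords.   *)
(* In a forest diagram the components of the graph of crossings seen so far,   *)
(* restricted to the open chords, are intervals of the stack, and whether a    *)
(* given chord may be closed depends only on the sizes of these intervals.     *)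
(* Forest diagrams with m components are thus the paths of an automaton whose  *)
(* states are lists of positive integers. The generating functions of the      *)
(* paths from all states are polynomials in x, u, and two algebraic series F   *)
(* and B with F = 1 + u x^2 F^2 B and B = 1 + x^2 F^2 B^3; the paths from the  *)
(* empty state are counted by F, whose coefficients are the claimed ones.      *)

Require Import Defs.
From mathcomp Require Import all_boot all_order all_algebra.
From mathcomp Require Import ring zify.

Set Implicit Arguments.
Unset Strict Implicit.
Unset Printing Implicit Defensive.

Import Order.TTheory GRing.Theory Num.Theory.

(** A diagram is a fixed-point-free involution, read one point at a time. A point either opens a
    chord, so far an isolated vertex, or closes the chord opened at some [a], which then crosses
    exactly the open chords above it on the stack. The graph seen so far thus gains a star centred
    at [a]. It stays a forest iff [a] and the chords above it lie in pairwise different components;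
    otherwise the cycle persists in every completion. Which closings survive therefore depends only
    on the sizes of the blocks that the components cut on the stack, and [card_forest_involutions]
    identifies the number of forest diagrams with [num_paths].

    The paths are counted by solving the first-step equations of this automaton. Put P = x F B. The
    solution W([]) = F, W(b :: st) = P^b (u W(st) + B S(st)) works because of P (1 - x P (u + B)) =
    x and B = 1 + P^2 B, both consequences of the equations of F and B; this is [num_paths_coefs].
    The explicit coefficients [FB_coef] satisfy the recurrences given by those equations, and the
    claimed number is the coefficient of x^(2n) u^m in F. *)

(* The points are read in increasing order. A state lists the numbers of open  *)
(* chords in the successive components that still have one, topmost first.     *)
(* Closing a chord makes it cross all open chords above it, so it keeps the    *)
(* graph acyclic iff every component above is reduced to one open chord and    *)
(* the chord is the topmost of its own component; all of these then merge.     *)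
(* Here k counts the singletons already skipped, and the first entry of a      *)
(* result is the size of the merged component, which is finished when 0.       *)
Fixpoint closings (k : nat) (st : seq nat) : seq (nat * seq nat) :=
  if st is b :: st' then
    (k + b.-1, st') :: (if b == 1 then closings k.+1 st' else [::])
  else [::].

(* Ways to read d more points from state st, after c finished components, and  *)
(* to end with no open chord and M components.                                 *)
Fixpoint num_paths (M d c : nat) (st : seq nat) : nat :=
  if d is d'.+1 then
    num_paths M d' c (1 :: st) +
    \sum_(x <- closings 0 st)
      (if x.1 is 0 then num_paths M d' c.+1 x.2 else num_paths M d' c (x.1 :: x.2))
  else (st == [::]) && (c == M).

(** * Adding edges to a forest *)

Section Graph.
Variable T : finType.
Implicit Types (e : rel T) (u v x y : T).

Definition add_edge e u v x y :=
  [|| e x y, (x == u) && (y == v) | (x == v) && (y == u)].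
Arguments add_edge e u v x y /.

Lemma add_edge_sym e u v : symmetric e -> symmetric (add_edge e u v).
Proof.
move=> se x y; rewrite /= se.
by case: (x == u); case: (x == v); case: (y == u); case: (y == v).
Qed.

Lemma acyclic_sub e e' : subrel e e' -> acyclic e' -> acyclic e.
Proof.
move=> sub /acyclicP acy; apply/acyclicP => s /andP[cyc us].
by apply: acy; apply/andP; split=> //; apply: sub_cycle cyc.
Qed.

Lemma connect_add_edge e u v x y : symmetric e ->
  connect (add_edge e u v) x y =
  [|| connect e x y, connect e x u && connect e v y | connect e x v && connect e u y].
Proof.
move=> se; have cs := sym_connect_sym se.
have sub : subrel (connect e) (connect (add_edge e u v)).
  by apply: connect_sub => a b eab; apply: connect1; rewrite /= eab.
apply/idP/idP => [/connectP[p]|].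
  elim: p x => [|z p IH] x /= => [_ ->|/andP[exz pz] ly]; first by rewrite connect0.
  have {IH pz ly} := IH z pz ly.
  case/or3P: exz => [/connect1 exz|/andP[/eqP-> /eqP->]|/andP[/eqP-> /eqP->]].
  - case/or3P=> [zy|/andP[zu vy]|/andP[zv uy]].
    + by rewrite (connect_trans exz zy).
    + by rewrite (connect_trans exz zu) vy orbT.
    + by rewrite (connect_trans exz zv) uy !orbT.
  - by case/or3P=> [h|/andP[_ h]|/andP[_ h]]; rewrite h ?connect0 ?orbT.
  - by case/or3P=> [h|/andP[_ h]|/andP[_ h]]; rewrite h ?connect0 ?orbT.
have uv : connect (add_edge e u v) u v by apply: connect1; rewrite /= !eqxx orbT.
have vu : connect (add_edge e u v) v u by apply: connect1; rewrite /= !eqxx !orbT.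
case/or3P=> [/sub//|/andP[/sub xu /sub vy]|/andP[/sub xv /sub uy]].
- exact: connect_trans (connect_trans xu uv) vy.
- exact: connect_trans (connect_trans xv vu) uy.
Qed.

(** A long cycle through both [u] and [v] is cut by them into two arcs; an arc with an interior
    vertex uses no new edge and would join [u] to [v] in [e]. *)
Lemma acyclic_add_edge e u v : symmetric e -> ~~ connect e u v ->
  acyclic e -> acyclic (add_edge e u v).
Proof.
move=> se nuv /acyclicP acy; apply/acyclicP => s /andP[cyc us].
have uNv : u != v by apply: contraNneq nuv => ->; rewrite connect0.
have avoid w : w \in [:: u; v] -> {in predC1 w &, subrel (add_edge e u v) e}.
  rewrite !inE => /orP[]/eqP-> x y /= xw yw; case/or3P=> // /andP[/eqP ex /eqP ey];
  by move: xw yw; rewrite !inE ex ey eqxx.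
have notin w : w \in [:: u; v] -> w \notin s -> size s <= 2.
  move=> wuv ws; apply: acy; apply/andP; split=> //.
  apply: (sub_in_cycle (avoid w wuv)) cyc.
  by apply/allP => x xs; rewrite !inE; apply: contraNneq ws => <-.
have vin : v \in [:: u; v] by rewrite !inE eqxx orbT.
have uin : u \in [:: u; v] by rewrite !inE eqxx.
case: (boolP (u \in s)) => [us'|]; last exact: notin.
case: (boolP (v \in s)) => [vs'|]; last exact: notin.
have [i p def_s] := rot_to us'.
rewrite -(size_rot i s) def_s.
move: cyc us vs'; rewrite -(rot_cycle i) -(rot_uniq i) -(mem_rot i) def_s.
rewrite inE eq_sym (negPf uNv) /= => cyc /andP[up unp] vp.
case/splitPr: vp cyc up unp => p1 p2.
rewrite rcons_cat /= cat_path /= => /and3P[c1 cv c2] up unp.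
case: p1 c1 cv up unp => [|z p1] /=.
  (* The arc from [u] to [v] is a single edge, so the return arc from [v] to [u] is used; if it is
     also a single edge, the cycle has only two vertices. *)
  move=> _ _; case: p2 c2 => [|z p2] //= /andP[vz pz].
  rewrite !inE !negb_or => /and3P[_ uz up2] /and3P[vp2 _ _].
  case/negP: nuv; rewrite (sym_connect_sym se).
  apply/connectP; exists (z :: rcons p2 u); last by rewrite /= last_rcons.
  case/andP: vp2 => vNz vp2.
  rewrite /=; apply/andP; split.
    case/or3P: vz => // /andP[/eqP h1 /eqP h2].
      by rewrite h1 eqxx in uNv.
    by rewrite h2 eqxx in uz.
  apply: (sub_in_path (avoid v vin)) pz => /=.
  rewrite eq_sym vNz all_rcons /= uNv /=.
  by apply/allP => x xp; rewrite /=; apply: contraNneq vp2 => <-.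
move=> /andP[uz pz] lv; rewrite inE negb_or mem_cat negb_or !inE negb_or.
case/and4P=> [uNz up1 _ _] /andP[+ _]; rewrite mem_cat !inE !negb_or.
case/and3P=> [_ zNv _]; case/negP: nuv.
apply/connectP; exists (z :: rcons p1 v); last by rewrite /= last_rcons.
rewrite /=; apply/andP; split.
  case/or3P: uz => // /andP[/eqP h1 /eqP h2].
    by rewrite h2 eqxx in zNv.
  by rewrite h2 eqxx in uNz.
apply: (sub_in_path (avoid u uin)); last by rewrite rcons_path pz.
rewrite /= eq_sym uNz all_rcons /= eq_sym uNv /=.
by apply/allP => x xp; rewrite /=; apply: contraNneq up1 => <-.
Qed.

Lemma cyclic_add_edge e e' u v : u != v -> connect e u v -> ~~ e u v ->
  subrel (add_edge e u v) e' -> ~~ acyclic e'.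
Proof.
move=> uNv /connectP[p0 pu lv] neuv sub; apply/negP => /acyclicP acy.
case/shortenP: pu lv => p pu up _ lv {p0}.
(* A simple path from [u] to [v] on at most two vertices would mean [u = v] or an edge of [e]; a
   longer one is closed into a cycle by the new edge. *)
suff : size (u :: p) <= 2.
  case: p pu lv {up} => [|z [|z' p]] //= => [_ uv|].
    by rewrite uv eqxx in uNv.
  by rewrite andbT => uz zv; rewrite zv uz in neuv.
apply: acy; apply/andP; split=> //=.
rewrite rcons_path; apply/andP; split.
  by apply: sub_path pu => x y exy; apply: sub; rewrite /= exy.
by apply: sub; rewrite -lv /= !eqxx !orbT.
Qed.

Lemma n_comp_split e (a b : {pred T}) :
  n_comp e a = n_comp e [predI a & b] + n_comp e [predI a & [predC b]].
Proof.
rewrite /n_comp_mem -(cardID b); congr (_ + _); apply: eq_card => x;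
  rewrite !inE; by case: (roots e x); case: (x \in a); case: (x \in b).
Qed.

Lemma n_comp_eq_in e e' (a b : {pred T}) : a =i b ->
  {in a, connect e =2 connect e'} -> n_comp e a = n_comp e' b.
Proof.
move=> ab ce; apply: eq_card => x; rewrite !inE -ab.
case: (boolP (x \in a)) => xa; rewrite ?andbF // !andbT.
by rewrite /roots /fingraph.root (eq_pick (ce x xa)).
Qed.

(** The union [cl] of the components of [u] and [v] has two roots before and one after; outside it,
    connectivity is unchanged. *)
Lemma n_comp_add_edge e u v (a : {pred T}) : symmetric e -> ~~ connect e u v ->
  closed e a -> u \in a -> v \in a ->
  n_comp e a = (n_comp (add_edge e u v) a).+1.
Proof.
move=> se nuv cla ua va.
have se' := add_edge_sym u v se; have cs := sym_connect_sym se.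
have cs' := sym_connect_sym se'.
pose cl := closure e (pred2 u v).
have memcl x : (x \in cl) = connect e x u || connect e x v.
  rewrite /cl; apply/pred0Pn/orP => [[y /andP[xy]]|].
    by rewrite inE /= => /orP[]/eqP <-; [left|right].
  by case=> h; [exists u|exists v]; rewrite /= !inE eqxx ?orbT andbT.
have mema x w : w \in a -> connect e x w -> x \in a.
  by move=> wa xw; rewrite (closed_connect cla xw).
have cla' : [predI a & cl] =i cl.
  move=> x; rewrite inE andbC /= memcl; apply: andb_idr.
  by case/orP; apply: mema.
rewrite (n_comp_split e a cl) (n_comp_split (add_edge e u v) a cl).
have -> : n_comp e [predI a & cl] = 2.
  by rewrite (eq_n_comp_r cla') n_comp_closure2 // nuv.
have -> : n_comp (add_edge e u v) [predI a & cl] = 1.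
  rewrite (eq_n_comp_r cla').
  have <- : n_comp (add_edge e u v) (closure (add_edge e u v) (pred2 u v)) = 1.
    by rewrite n_comp_closure2 // connect_add_edge // !connect0 orbT.
  apply: eq_n_comp_r => x; rewrite memcl; apply/idP/pred0Pn.
    case/orP => h; exists u; rewrite /= !inE eqxx andbT connect_add_edge // h ?orbT //.
    by rewrite connect0 !orbT.
  case=> y /andP[xy yw]; have {xy}: connect (add_edge e u v) x y by [].
  rewrite connect_add_edge //; case/orP: yw => /eqP->.
  - by case/or3P=> [->|/andP[-> _]|/andP[-> _]]; rewrite ?orbT.
  - by case/or3P=> [->|/andP[-> _]|/andP[-> _]]; rewrite ?orbT.
rewrite !addSn add0n; congr (_.+2).
apply: n_comp_eq_in => // x; rewrite !inE memcl negb_or => /andP[_ /andP[xu xv]] y.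
by rewrite connect_add_edge // (negPf xu) (negPf xv) !orbF.
Qed.

Lemma n_comp_isolated e w (a b : {pred T}) : symmetric e -> (forall y, ~~ e w y) ->
  w \notin a -> b =i [predU1 w & a] -> n_comp e b = (n_comp e a).+1.
Proof.
move=> se iso wa bE; have cs := sym_connect_sym se.
have cw y : connect e w y = (y == w).
  apply/connectP/eqP => [[[|z p] //= /andP[]]|->]; last by exists nil.
  by rewrite (negPf (iso z)).
rewrite (n_comp_split e b (pred1 w)) -[RHS]add1n; congr (_ + _).
  rewrite -(n_comp_connect cs w); apply: eq_n_comp_r => x.
  by rewrite !inE bE inE -topredE /= cw; case: (x == w); rewrite ?andbF.
apply: eq_n_comp_r => x; rewrite !inE bE inE.
by case: eqP => [->|]; rewrite ?(negPf wa) ?andbT ?andbF.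
Qed.

(** * Traces of the components on the open vertices *)

Definition same_block (bl : seq (seq T)) x y :=
  has (fun B : seq T => (x \in B) && (y \in B)) bl.

Lemma same_block_in bl (B : seq T) x y : uniq (flatten bl) -> B \in bl -> y \in B ->
  same_block bl x y = (x \in B).
Proof.
move=> + Bbl yB; case/splitPr: Bbl => b1 b2.
rewrite flatten_cat /= !cat_uniq has_cat negb_or.
case/and5P=> _ /andP[d1 _] _ d2 _.
have n1 C : C \in b1 -> y \notin C.
  move=> Cb; apply: contra d1 => yC; apply/hasP; exists y => //.
  by apply/flattenP; exists C.
have n2 C : C \in b2 -> y \notin C.
  move=> Cb; apply: contra d2 => yC; apply/hasP; exists y => //.
  by apply/flattenP; exists C.
rewrite /same_block has_cat /= yB andbT.
rewrite (_ : has _ b1 = false); last by apply/hasPn => C /n1; rewrite negb_and => ->; rewrite orbT.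
rewrite (_ : has _ b2 = false) ?orbF //.
by apply/hasPn => C /n2; rewrite negb_and => ->; rewrite orbT.
Qed.

Lemma same_block_mem bl x y :
  same_block bl x y -> (x \in flatten bl) && (y \in flatten bl).
Proof.
by case/hasP=> B Bb /andP[xB yB]; apply/andP; split; apply/flattenP; exists B.
Qed.

(* bl lists the traces on the open vertices of the components of the forest e  *)
(* inside A that meet them; the other components are counted by c.             *)
Record forest_blocks e (A : {pred T}) (bl : seq (seq T)) (c : nat) : Prop :=
  ForestBlocks {
    fb_sym : symmetric e;
    fb_acyclic : acyclic e;
    fb_closed : closed e A;
    fb_sub : {subset flatten bl <= A};
    fb_uniq : uniq (flatten bl);
    fb_connect : {in flatten bl &, connect e =2 same_block bl};
    fb_n_comp : n_comp e A = size bl + c }.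

Lemma forest_blocks_ext e e' (A A' : {pred T}) bl c : e =2 e' -> A =i A' ->
  forest_blocks e A bl c -> forest_blocks e' A' bl c.
Proof.
move=> ee AA [h1 h2 h3 h4 h5 h6 h7].
have ce : connect e =2 connect e' by apply: eq_connect.
split=> //.
- by move=> x y; rewrite -!ee.
- by apply: acyclic_sub h2 => x y; rewrite ee.
- by move=> x y; rewrite -ee -!AA => /h3.
- by move=> x /h4; rewrite AA.
- by move=> x y xb yb; rewrite -ce h6.
- by rewrite -h7; apply/esym/n_comp_eq_in => // x _ y; rewrite ce.
Qed.

(** Two blocks become one across a single new edge, hence without a cycle. Putting [o] in front of
    [B] leaves [flatten], that is the stack order, unchanged. *)
Lemma forest_blocks_merge e A pre o B rest c a : a \in B ->
  forest_blocks e A (pre ++ [:: o] :: B :: rest) c ->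
  forest_blocks (add_edge e a o) A (pre ++ (o :: B) :: rest) c.
Proof.
set bl := pre ++ _; move=> aB [se acy cl sub un conn nc].
have fl : flatten (pre ++ (o :: B) :: rest) = flatten bl.
  by rewrite /bl !flatten_cat /=.
have Bbl : B \in bl by rewrite /bl mem_cat !inE eqxx !orbT.
have obl : [:: o] \in bl by rewrite /bl mem_cat inE eqxx !orbT.
have mb C x : C \in bl -> x \in C -> x \in flatten bl.
  by move=> Cb xC; apply/flattenP; exists C.
have oo : o \in [:: o] by rewrite inE.
have oS := mb _ _ obl oo; have aS := mb _ _ Bbl aB.
have sa x : same_block bl x a = (x \in B) by apply: same_block_in.
have so x : same_block bl x o = (x == o).
  by rewrite (same_block_in _ un obl oo) inE.
have sC x y : same_block bl x y = same_block bl y x.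
  by apply: eq_has => C; rewrite andbC.
have oNB : o \notin B.
  move: un; rewrite /bl flatten_cat cat_uniq => /and3P[_ _] /= /andP[].
  by rewrite mem_cat negb_or => /andP[].
have nao : ~~ connect e a o.
  rewrite conn // so; by apply: contraNneq oNB => <-.
split.
- exact: add_edge_sym.
- exact: acyclic_add_edge.
- move=> x y /or3P[/cl//|/andP[/eqP-> /eqP->]|/andP[/eqP-> /eqP->]]; by rewrite !sub.
- by rewrite fl.
- by rewrite fl.
- move=> x y; rewrite fl => xS yS; rewrite connect_add_edge // !conn //.
  rewrite (sC o y) (sC a y) !sa !so /same_block /bl !has_cat /= !inE.
  move: (has _ pre) (has _ rest) (x \in B) (y \in B) (x == o) (y == o).
  by do 6 case.
- have := n_comp_add_edge se nao cl (sub _ aS) (sub _ oS).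
  rewrite nc /bl !size_cat /=; lia.
Qed.

Definition add_star e a (acc : seq T) : rel T :=
  foldr (fun o e' => add_edge e' a o) e acc.

Lemma add_starE e a acc x y :
  add_star e a acc x y = [|| e x y, (x == a) && (y \in acc) | (y == a) && (x \in acc)].
Proof.
elim: acc => [|o acc IH] /=; first by rewrite !andbF !orbF.
rewrite IH !inE.
by case: (e x y); case: (x == a); case: (y == a); case: (x == o); case: (y == o);
  case: (x \in acc); case: (y \in acc).
Qed.

Lemma forest_blocks_star e A acc B rest c a : a \in B ->
  forest_blocks e A ([seq [:: o] | o <- acc] ++ B :: rest) c ->
  forest_blocks (add_star e a acc) A ((acc ++ B) :: rest) c.
Proof.
move=> aB; rewrite -[(acc ++ B) :: rest]cat0s -[_ ++ B :: rest]cat0s.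
elim: acc [::] => [|o acc IH] pre //= H.
apply: forest_blocks_merge; first by rewrite mem_cat aB orbT.
by rewrite -cat_rcons; apply: IH; rewrite cat_rcons.
Qed.

(** If one of the two connected vertices is the centre, its edge to the other closes a cycle.
    Otherwise the edge from [a] to [x] connects [a] to [y], and the edge from [a] to [y] closes the
    cycle. *)
Lemma cyclic_star e e' a x y (acc : seq T) : 
  (forall o, o \in a :: acc -> ~~ e a o) ->
  x \in a :: acc -> y \in a :: acc -> x != y -> a \notin acc -> symmetric e ->
  connect e x y -> subrel (add_star e a acc) e' -> ~~ acyclic e'.
Proof.
move=> nadj; have one z : symmetric e -> z \in acc -> a \notin acc -> connect e a z ->
    subrel (add_star e a acc) e' -> ~~ acyclic e'.
  move=> se zacc aN az sub; apply: (@cyclic_add_edge e e' a z) => //.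
  - by apply: contraNneq aN => ->.
  - by apply: nadj; rewrite inE zacc orbT.
  - move=> s t /= h; apply: sub; rewrite add_starE.
    by case/or3P: h => [->|/andP[-> /eqP->]|/andP[/eqP-> ->]]; rewrite ?zacc ?orbT.
rewrite !inE => /orP[/eqP->|xacc] /orP[/eqP->|yacc]; rewrite ?eqxx // => xNy aN se xy sub.
- exact: (one y).
- by apply: (one x) => //; rewrite (sym_connect_sym se).
apply: (@cyclic_add_edge (add_edge e a x) e' a y).
- by apply: contraNneq aN => ->.
- by rewrite connect_add_edge // connect0 xy /= orbT.
- rewrite /= !negb_or nadj ?inE ?yacc ?orbT //=.
  rewrite (eq_sym y) (negPf xNy) andbF /=.
  by apply: contra aN => /andP[/eqP->].
- move=> s t /= h; apply: sub; rewrite add_starE.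
  by case/or3P: h => [/or3P[->|/andP[-> /eqP->]|/andP[/eqP-> ->]]
    |/andP[-> /eqP->]|/andP[/eqP-> ->]]; rewrite ?xacc ?yacc ?orbT.
Qed.

Definition push_block (B : seq T) bl := if B is [::] then bl else B :: bl.

Lemma flatten_push_block B bl : flatten (push_block B bl) = B ++ flatten bl.
Proof. by case: B. Qed.

(** The closed vertex [a] leaves the stack but not the graph: its component keeps the block
    [acc ++ b], or is finished and moves to the counter when that is empty. *)
Lemma forest_blocks_drop e A acc a b rest c :
  forest_blocks e A ((acc ++ a :: b) :: rest) c ->
  forest_blocks e A (push_block (acc ++ b) rest) (if acc ++ b is [::] then c.+1 else c).
Proof.
case=> se acy cl sub un conn nc.
have ss : subseq (acc ++ b ++ flatten rest) (flatten ((acc ++ a :: b) :: rest)).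
  by rewrite /= -catA; apply: cat_subseq => //; exact: subseq_cons.
have ms x : x \in acc ++ b ++ flatten rest -> x \in flatten ((acc ++ a :: b) :: rest).
  exact: mem_subseq.
have aN : a \notin acc ++ b ++ flatten rest.
  move: un => /=; rewrite -catA cat_uniq /= => /and3P[_ + /andP[+ _]].
  by rewrite !mem_cat !negb_or => /andP[-> _] /andP[-> ->].
split=> //.
- by rewrite flatten_push_block -catA => x /ms/sub.
- by rewrite flatten_push_block -catA; apply: subseq_uniq ss un.
- rewrite flatten_push_block -catA => x y xS yS; rewrite conn ?ms //.
  have xa : x == a = false by apply: contraNF aN => /eqP<-.
  have ya : y == a = false by apply: contraNF aN => /eqP<-.
  have -> : same_block (push_block (acc ++ b) rest) x y = same_block ((acc ++ b) :: rest) x y.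
    by rewrite /push_block; case: (acc ++ b).
  by rewrite /same_block /= !mem_cat !inE xa ya.
- by rewrite nc /=; case: (acc ++ b) => /=; lia.
Qed.

(* f a is the contribution of closing a, which vanishes when this creates a    *)
(* cycle.                                                                      *)
Lemma sum_closings_blocks (f : T -> nat) (g : nat * seq nat -> nat) BL :
  all (fun B => B != [::]) BL ->
  (forall s1 a s2 x y, flatten BL = s1 ++ a :: s2 -> x \in a :: s1 -> y \in a :: s1 ->
     x != y -> same_block BL x y -> f a = 0) ->
  (forall acc a b rest, BL = [seq [:: o] | o <- acc] ++ (a :: b) :: rest ->
     f a = g (size acc + size b, [seq size B | B <- rest])) ->
  uniq (flatten BL) ->
  \sum_(a <- flatten BL) f a = \sum_(x <- closings 0 [seq size B | B <- BL]) g x.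
Proof.
move=> ne dead alive un.
suff gen bl acc : all (fun B => B != [::]) bl -> BL = [seq [:: o] | o <- acc] ++ bl ->
    \sum_(a <- flatten bl) f a =
    \sum_(x <- closings (size acc) [seq size B | B <- bl]) g x.
  exact: (gen BL [::]).
elim: bl acc {ne} => [|B bl IH] acc /=; first by rewrite !big_nil.
case: B => [|a b] //= ne eBL.
rewrite big_cons big_cat /= big_cons; congr (_ + _); first exact: alive eBL.
have fl : flatten BL = acc ++ a :: b ++ flatten bl.
  by rewrite eBL flatten_cat flatten_seq1.
have sb x y : x \in a :: b -> y \in a :: b -> same_block BL x y.
  by move=> xb yb; rewrite eBL /same_block has_cat /= xb yb orbT.
(* A lower member of this block has [a] above it in its own component. *)
have -> : \sum_(a' <- b) f a' = 0.
  rewrite big_seq big1 // => a' a'b.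
  move: fl (a'b); case/splitPr: {+}a'b => b1 b2 fl _.
  apply: (dead (acc ++ a :: b1) a' (b2 ++ flatten bl) a a').
  - by rewrite fl -!catA.
  - by rewrite inE mem_cat inE eqxx !orbT.
  - by rewrite inE eqxx.
  - move: un; rewrite fl cat_uniq => /and3P[_ _ /= /andP[+ _]].
    by apply: contraNneq => ->; rewrite !mem_cat inE eqxx !orbT.
  - by apply: sb; rewrite inE ?eqxx // a'b orbT.
rewrite add0n; case: b => [|b0 b] /= in eBL fl sb *.
  have eBL' : BL = [seq [:: o] | o <- rcons acc a] ++ bl by rewrite map_rcons cat_rcons.
  by have := IH (rcons acc a) ne eBL'; rewrite size_rcons.
(* Closing anything below this block crosses both [a] and [b0], which are already connected. *)
rewrite big_nil big_seq big1 // => a' a'b.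
case/splitPr: a'b fl => r1 r2 fl.
apply: (dead (acc ++ a :: b0 :: b ++ r1) a' r2 a b0).
- by rewrite fl -!catA /= -catA.
- by rewrite inE mem_cat inE eqxx !orbT.
- by rewrite inE mem_cat !inE eqxx !orbT.
- move: un; rewrite fl cat_uniq => /and3P[_ _ /= /andP[+ _]].
  by apply: contraNneq => ->; rewrite inE eqxx.
- by apply: sb; rewrite !inE eqxx ?orbT.
Qed.

End Graph.

(** * Reading a diagram point by point *)

Section Prefix.
Variable N : nat.
Implicit Types (p : {ffun 'I_N -> 'I_N}) (v : 'I_N -> nat) (x y a : 'I_N).

(* A chord is represented by its smaller end: v a is the other end of a chord  *)
(* opened at a, N if that chord is not closed yet, and a if a is not read yet. *)
(* Closing points and unread points are isolated vertices.                     *)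
Definition xgraph v : rel 'I_N :=
  fun a b => [&& a < b, b < v a & v a < v b] || [&& b < a, a < v b & v b < v a].

Lemma xgraph_sym v : symmetric (xgraph v).
Proof. by move=> a b; rewrite /xgraph orbC. Qed.

Lemma eq_xgraph v v' : v =1 v' -> xgraph v =2 xgraph v'.
Proof. by move=> e a b; rewrite /xgraph !e. Qed.

Definition fpf_involution p := [forall a, (p (p a) == a) && (p a != a)].

Definition prefix p (t : nat) a : nat :=
  if a < t then (if p a < t then p a : nat else N) else a.

Definition agree p t v := [forall a, prefix p t a == v a].

Definition openers (t : nat) v : {pred 'I_N} := [pred a : 'I_N | (a < t) && (a < v a)].

Definition partial_involution (t : nat) v := forall a,
  if a < t then v a = N \/ exists2 b : 'I_N, [/\ b < t, b != a & v a = b] & v b = a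
  else v a = a.

Definition openv v x := fun a => if a == x then N else v a.
Definition closev v a x := fun y : 'I_N => if y == a then x : nat else if y == x then a : nat else v y.

Lemma partial_involution_bound t v y : partial_involution t v ->
  (y < t /\ (v y = N \/ v y < t)) \/ (t <= y /\ v y = y).
Proof.
move/(_ y); case: ltnP => h; last by right.
by case=> [->|[b [bt _ ->] _]]; left; split=> //; [left|right].
Qed.

Lemma prefixS p x y : y != x -> (y < x -> p y != x) -> prefix p x.+1 y = prefix p x y.
Proof.
rewrite /prefix -!val_eqE /= => yx pyx.
have -> : (y < x.+1) = (y < x) by lia.
case: ifP => // /pyx pyx'.
by have -> : (p y < x.+1) = (p y < x) by lia.
Qed.

Lemma agree_open p x v : fpf_involution p -> partial_involution x v ->
  agree p x v && (x < p x) = agree p x.+1 (openv v x).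
Proof.
move=> /forallP fp pv.
have step a : a != x -> x < p x -> prefix p x.+1 a = prefix p x a.
  move=> ax xp; apply: prefixS => // lt; apply: contraTneq xp => e; rewrite -e.
  by case/andP: (fp a) => /eqP -> _; rewrite -leqNgt e ltnW.
have vx : v x = x by move: (pv x); rewrite ltnn.
apply/andP/forallP => [[/forallP ag xp] a|ag].
  rewrite /openv; case: (altP (a =P x)) => [->|ax]; last by rewrite step.
  by rewrite /prefix ltnS leqnn ltnS leqNgt xp.
have xp : x < p x.
  move: (ag x); rewrite /openv eqxx /prefix ltnSn => /eqP.
  by have := ltn_ord (p x); case: (ltnP (p x) x.+1); lia.
split=> //; apply/forallP => a; move: (ag a); rewrite /openv.
case: (altP (a =P x)) => [-> _|ax]; last by rewrite step.
by rewrite /prefix ltnn vx.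
Qed.

Lemma agree_close p x v a : fpf_involution p -> partial_involution x v ->
  a < x -> v a = N ->
  agree p x v && (p x == a) = agree p x.+1 (closev v a x).
Proof.
move=> /forallP fp pv ax va.
have pp y : p (p y) = y by case/andP: (fp y) => /eqP.
have vx : v x = x by move: (pv x); rewrite ltnn.
have xNa : (x == a) = false by rewrite -val_eqE /=; lia.
have step y : p x = a -> y != a -> y != x -> prefix p x.+1 y = prefix p x y.
  move=> e ya yx; apply: prefixS => // _.
  by apply: contra_neq ya => e2; rewrite -e -e2 pp.
apply/andP/forallP => [[/forallP ag /eqP px] y|ag].
  rewrite /closev; case: (altP (y =P a)) => [->|ya].
    by rewrite /prefix -px pp ltnSn px (ltn_trans ax).
  case: (altP (y =P x)) => [->|yx]; last by rewrite step.
  by rewrite /prefix ltnSn px (ltn_trans ax).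
have px : p x = a.
  move: (ag x); rewrite /closev eqxx xNa /prefix ltnSn => /eqP e; apply: val_inj => /=.
  by have := ltn_ord a; move: e; case: (ltnP (p x) x.+1); lia.
split; last by rewrite px.
apply/forallP => y; move: (ag y); rewrite /closev.
case: (altP (y =P a)) => [-> _|ya]; first by rewrite /prefix ax -px pp ltnn px va.
case: (altP (y =P x)) => [-> _|yx]; last by rewrite step.
by rewrite /prefix ltnn vx.
Qed.

Lemma partial_involution_open x v :
  partial_involution x v -> partial_involution x.+1 (openv v x).
Proof.
move=> pv a; rewrite /openv; case: (a =P x) => [->|ax]; first by rewrite ltnSn; left.
have : val a <> val x by move/val_inj.
move=> /= ?; have := pv a; case: (ltnP a x) => h; last by case: ltnP; lia.
rewrite (ltn_trans h) // => -[->|[b [bx ba vab] vb]]; [by left|right].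
exists b; first by split=> //; lia.
by rewrite -val_eqE /=; case: eqP; lia.
Qed.

Lemma partial_involution_close x v a : partial_involution x v -> a < x -> v a = N ->
  partial_involution x.+1 (closev v a x).
Proof.
move=> pv ax va y; rewrite /closev.
have xNa : (x == a) = false by rewrite -val_eqE /=; lia.
case: (y =P a) => [->|ya].
  rewrite (ltn_trans ax) //; right; exists x; first by rewrite xNa.
  by rewrite xNa eqxx.
case: (y =P x) => [->|yx].
  rewrite ltnSn; right; exists a; last by rewrite eqxx.
  by rewrite (ltn_trans ax) // eq_sym xNa.
have : val y <> val x by move/val_inj.
move=> /= ?; have := pv y; case: (ltnP y x) => h; last by case: ltnP; lia.
rewrite (ltn_trans h) // => -[->|[b [bx ba vab] vb]]; [by left|right].
exists b; first by split=> //; lia.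
case: eqP => [e|_]; first by move: vb; rewrite e va; have := ltn_ord y; lia.
by rewrite -val_eqE /=; case: eqP; lia.
Qed.

Lemma xgraph_open x v : partial_involution x v -> xgraph (openv v x) =2 xgraph v.
Proof.
move=> pv y z; rewrite /xgraph /openv.
have := partial_involution_bound y pv; have := partial_involution_bound z pv.
have := ltn_ord y; have := ltn_ord z; rewrite -!val_eqE /=.
by case: (nat_of_ord y =P x); case: (nat_of_ord z =P x); lia.
Qed.

Lemma xgraph_close x v a y z : partial_involution x v -> a < x -> v a = N ->
  xgraph (closev v a x) y z =
  [|| xgraph v y z, (y == a) && [&& z < x, v z == N & a < z]
    | (z == a) && [&& y < x, v y == N & a < y]].
Proof.
move=> pv ax va; rewrite /xgraph /closev.
have := partial_involution_bound y pv; have := partial_involution_bound z pv.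
have : y = a :> nat -> v y = N by move/val_inj->.
have : z = a :> nat -> v z = N by move/val_inj->.
have := ltn_ord y; have := ltn_ord z; have := ltn_ord a; have := ltn_ord x; rewrite -!val_eqE /=.
case: (nat_of_ord y =P a); case: (nat_of_ord z =P a);
case: (nat_of_ord y =P x); case: (nat_of_ord z =P x); lia.
Qed.

(** Chords once seen to cross still cross in every completion, so a cycle met during the reading is
    final. *)
Lemma agree_xgraph_sub p t v : agree p t v -> subrel (xgraph v) (xgraph (fun a => p a)).
Proof.
move=> /forallP ag y z; rewrite /xgraph -!(eqP (ag _)) /prefix.
have := ltn_ord (p y); have := ltn_ord (p z).
have := ltn_ord y; have := ltn_ord z.
case: (ltnP y t); case: (ltnP z t); case: (ltnP (p y) t); case: (ltnP (p z) t); lia.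
Qed.

(** The involutions are sorted by the partner of [x]: a later point, or one of the open chords
    listed by [S]. *)
Lemma card_agree_step (Q : pred {ffun 'I_N -> 'I_N}) x v (S : seq 'I_N) :
  partial_involution x v -> uniq S -> (forall a, (a \in S) = (a < x) && (v a == N)) ->
  #|[set p | [&& fpf_involution p, agree p x v & Q p]]| =
  #|[set p | [&& fpf_involution p, agree p x.+1 (openv v x) & Q p]]| +
  \sum_(a <- S) #|[set p | [&& fpf_involution p, agree p x.+1 (closev v a x) & Q p]]|.
Proof.
move=> pv uS mS; set X := [set p | _].
rewrite -(cardsID [set p : {ffun 'I_N -> 'I_N} | x < p x] X); congr (_ + _).
  apply: eq_card => p; rewrite !inE; case: (boolP (fpf_involution p)) => //= fp.
  by rewrite -agree_open // andbAC.
rewrite -sum1_card (partition_big (fun p : {ffun 'I_N -> 'I_N} => p x) [in S]) /=.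
  rewrite -big_uniq //; apply: eq_big_seq => a; rewrite mS => /andP[ax /eqP va].
  rewrite sum1_card; apply: eq_card => p; rewrite !inE.
  rewrite unfold_in /= !inE.
  case: (boolP (fpf_involution p)) => [fp|]; last by rewrite andbF.
  rewrite -agree_close //=; case: (p x =P a) => [->|]; rewrite ?andbF ?andbT //.
  by rewrite -leqNgt (ltnW ax).
move=> p; rewrite !inE => /andP[xp /and3P[fp ag _]].
rewrite mS; have /forallP/(_ x)/andP[/eqP ppx pxx] := fp.
have px : p x < x by move: pxx; rewrite -val_eqE /=; lia.
rewrite px /= -(eqP (forallP ag (p x))) /prefix px ppx ltnn; exact: eqxx.
Qed.

End Prefix.

Lemma forest_blocks_isolated (T : finType) (e : rel T) (A : {pred T}) bl c w :
  (forall y, ~~ e w y) -> w \notin A -> forest_blocks e A bl c ->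
  forest_blocks e [predU1 w & A] ([:: w] :: bl) c.
Proof.
move=> iso wA [se acy cl sub un conn nc]; have cs := sym_connect_sym se.
have wbl : w \notin flatten bl by apply: contra wA; apply: sub.
have cw y : connect e w y = (y == w).
  apply/connectP/eqP => [[[|z q] //= /andP[]]|->]; last by exists nil.
  by rewrite (negPf (iso z)).
have sbw y : same_block bl w y = false /\ same_block bl y w = false.
  by split; apply: contraNF wbl => /same_block_mem/andP[].
split=> //=.
- move=> x y exy; rewrite !inE (cl _ _ exy).
  have /negPf-> : x != w by apply: contraTneq exy => ->.
  by have /negPf-> // : y != w; apply: contraTneq exy => ->; rewrite se.
- move=> x; rewrite !inE => /orP[->//|/sub ->]; exact: orbT.
- by rewrite wbl.
- move=> x y; rewrite !inE => /orP[/eqP->|xb] /orP[/eqP->|yb].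
  + by rewrite connect0 /= ?inE eqxx.
  + by rewrite cw /= ?inE eqxx /= (sbw y).1 orbF.
  + by rewrite cs cw /= ?inE eqxx andbT /= (sbw x).2 orbF.
  have xw : x == w = false by apply: contraNF wbl => /eqP <-.
  by rewrite /= ?inE xw /= conn.
- by rewrite (@n_comp_isolated _ e w A) // nc.
Qed.

(** * The invariant of the reading and its preservation *)

Section Scan.
Variable N : nat.
Implicit Types (p : {ffun 'I_N -> 'I_N}) (v : 'I_N -> nat) (x y a : 'I_N).

Definition above : rel 'I_N := fun x y => y < x.

Lemma above_trans : transitive above.
Proof. by move=> y x z; rewrite /above => h1 h2; apply: ltn_trans h1. Qed.

Lemma sorted_above (s1 s2 : seq 'I_N) a z : sorted above (s1 ++ a :: s2) ->
  (z \in s1) = (z \in s1 ++ a :: s2) && (a < z).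
Proof.
rewrite (sorted_pairwise above_trans) pairwise_cat /= => /and3P[/allrelP h _ /andP[/allP h2 _]].
rewrite mem_cat inE; case: (boolP (z \in s1)) => [zs|zs] /=.
  by have := h z a zs; rewrite inE eqxx => /(_ isT).
by case: eqP => [->|_]; rewrite /= ?ltnn //; apply/esym/negP => /andP[/h2]; rewrite /above; lia.
Qed.

Record scan_state (t : nat) v bl c : Prop := ScanState {
  ss_partial : partial_involution t v;
  ss_nonempty : all (fun B => B != [::]) bl;
  ss_sorted : sorted above (flatten bl);
  ss_mem : forall a, (a \in flatten bl) = (a < t) && (v a == N);
  ss_blocks : forest_blocks (xgraph v) (openers t v) bl c }.

Lemma scan_start : scan_state 0 (fun a => a : nat) [::] 0.
Proof.
have e0 x y : xgraph (fun a : 'I_N => a : nat) x y = false by rewrite /xgraph; lia.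
split=> //; split=> //.
- exact: xgraph_sym.
- apply/acyclicP => -[//|x [//|y s]] /andP[/=]; by rewrite e0.
- by apply: eq_card0 => x; rewrite !inE /= andbF.
Qed.

Lemma scan_open x v bl c :
  scan_state x v bl c -> scan_state x.+1 (openv v x) ([:: x] :: bl) c.
Proof.
case=> pv ne so me fb.
have vx : v x = x by move: (pv x); rewrite ltnn.
split=> //=.
- exact: partial_involution_open.
- rewrite path_sortedE; last exact: above_trans.
  by rewrite so andbT; apply/allP => y; rewrite me => /andP[].
- move=> a; rewrite inE me /openv; case: eqP => [->|ax] /=; first by rewrite ltnSn eqxx.
  have : val a <> val x by move/val_inj.
  by move=> /= ?; congr andb; lia.
apply: (@forest_blocks_ext _ (xgraph v) _ [predU1 x & openers x v]).
- by move=> y z; rewrite xgraph_open.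
- move=> y; rewrite !inE /openv; case: eqP => [->|yx] /=; first by rewrite ltnSn ltn_ord.
  have : val y <> val x by move/val_inj.
  by move=> /= ?; congr andb; lia.
apply: forest_blocks_isolated => //; last by rewrite !inE ltnn.
move=> y; rewrite -(xgraph_open pv) /xgraph /openv eqxx.
have := partial_involution_bound y pv; have := ltn_ord y; have := ltn_ord x.
by case: eqP => [->|]; lia.
Qed.

(** The stack is listed by decreasing openers, so [s1] consists of the open chords opened after [a],
    which are those crossed when [a] is closed. *)
Lemma xgraph_close_star x v bl c s1 a s2 : scan_state x v bl c ->
  flatten bl = s1 ++ a :: s2 -> xgraph (closev v a x) =2 add_star (xgraph v) a s1.
Proof.
case=> pv ne so me _ fl y z.
have /andP[ax /eqP va] : (a < x) && (v a == N).
  by rewrite -me fl mem_cat inE eqxx orbT.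
rewrite fl in so; rewrite xgraph_close // add_starE !(sorted_above _ so) -fl !me.
by rewrite !andbA.
Qed.

Lemma scan_close x v acc a b rest c :
  scan_state x v ([seq [:: o] | o <- acc] ++ (a :: b) :: rest) c ->
  scan_state x.+1 (closev v a x) (push_block (acc ++ b) rest)
    (if acc ++ b is [::] then c.+1 else c).
Proof.
set bl := _ ++ _ => ss; have [pv ne so me fb] := ss.
have fl : flatten bl = acc ++ a :: (b ++ flatten rest).
  by rewrite flatten_cat flatten_seq1.
have /andP[ax /eqP va] : (a < x) && (v a == N).
  by rewrite -me fl mem_cat inE eqxx orbT.
have vx : v x = x by move: (pv x); rewrite ltnn.
have un := fb_uniq fb.
have ss' : subseq (acc ++ b ++ flatten rest) (flatten bl).
  by rewrite fl; apply: cat_subseq => //; exact: subseq_cons.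
split.
- exact: partial_involution_close.
- move: ne; rewrite all_cat /= => /andP[_ ner].
  by case: (acc ++ b).
- by rewrite flatten_push_block -catA; apply: subseq_sorted so => //; exact: above_trans.
- move=> y; rewrite flatten_push_block -catA /closev.
  have mY : (y \in acc ++ b ++ flatten rest) = (y != a) && (y \in flatten bl).
    rewrite fl !mem_cat inE; move: un; rewrite fl cat_uniq /= => /and4P[_ + + _].
    rewrite negb_or => /andP[a1 _] a2; case: eqP => [->|_]; last by rewrite mem_cat.
    by rewrite (negPf a1) -mem_cat (negPf a2).
  rewrite mY me; case: (y =P a) => [->|ya] /=; first by have := ltn_ord x; lia.
  case: (y =P x) => [->|yx]; first by have := ltn_ord a; lia.
  have : val y <> val x by move/val_inj.
  by move=> /= ?; congr andb; lia.
apply: forest_blocks_drop.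
apply: (@forest_blocks_ext _ (add_star (xgraph v) a acc) _ (openers x v)).
- by move=> y z; rewrite (xgraph_close_star ss fl).
- move=> y; rewrite !inE /closev; case: (y =P a) => [->|ya].
    by have := ltn_ord a; lia.
  case: (y =P x) => [->|yx]; first by lia.
  have : val y <> val x by move/val_inj.
  by move=> /= ?; congr andb; lia.
exact: forest_blocks_star (mem_head a b) fb.
Qed.

Lemma scan_cyclic x v bl c s1 a s2 y z p : scan_state x v bl c ->
  flatten bl = s1 ++ a :: s2 -> y \in a :: s1 -> z \in a :: s1 -> y != z ->
  same_block bl y z -> agree p x.+1 (closev v a x) ->
  ~~ acyclic (xgraph (fun b => p b)).
Proof.
move=> ss fl ys zs yz sb ag; have [pv ne so me fb] := ss.
have sS w : w \in a :: s1 -> w \in flatten bl.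
  by rewrite fl mem_cat !inE => /orP[->|->]; rewrite ?orbT.
apply: (@cyclic_star _ (xgraph v) _ a y z s1) => //.
- move=> o /sS; rewrite me => /andP[_ /eqP vo].
  have := sS a; rewrite inE eqxx me => /(_ isT)/andP[_ /eqP va].
  by rewrite /xgraph vo va !ltnn !andbF.
- by rewrite fl in so; rewrite (sorted_above _ so) ltnn andbF.
- exact: xgraph_sym.
- by rewrite (fb_connect fb) ?sS.
- by move=> s t st; apply: agree_xgraph_sub ag _ _ _; rewrite (xgraph_close_star ss fl).
Qed.

Definition forest_involutions M t v :=
  [set p | [&& fpf_involution p, agree p t v & acyclic (xgraph (fun a => p a))
    && (n_comp (xgraph (fun a => p a)) [pred a : 'I_N | a < p a] == M)]].

(** Once all points are read, an open chord admits no completion; with an empty stack, [v] itself is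
    the unique one. *)
Lemma card_scan_end M v bl c : scan_state N v bl c ->
  #|forest_involutions M N v| = (bl == [::]) && (c == M).
Proof.
case=> pv ne so me fb.
have prN p a : prefix p N a = p a by rewrite /prefix !ltn_ord.
case: bl => [|B bl] /= in ne so me fb *; last first.
  apply: eq_card0 => p; rewrite !inE; apply/negP => /and3P[_ /forallP ag _].
  case: B => // a B in ne me fb so *.
  have := me a; rewrite inE eqxx /= => /esym/andP[_ /eqP va].
  by have := ag a; rewrite prN va => /eqP e; have := ltn_ord (p a); rewrite e ltnn.
have vN a : v a < N.
  have := me a; rewrite ltn_ord in_nil /= => h.
  by have := ltn_ord a; have := partial_involution_bound a pv; lia.
pose q := [ffun a => Ordinal (vN a)].
have qv : (fun a => q a : nat) =1 v by move=> a; rewrite ffunE.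
have qfpf : fpf_involution q.
  apply/forallP => a; have := pv a; rewrite ltn_ord => -[h|[b [_ ba vab] vb]].
    by have := vN a; rewrite h ltnn.
  have -> : q a = b by apply: val_inj; rewrite /= -vab; exact: qv.
  by rewrite ba andbT -val_eqE /= (qv b) vb.
have conn : n_comp (xgraph (fun a => q a)) [pred a : 'I_N | a < q a] = c.
  rewrite -[RHS]add0n -[0]/(size (Nil (seq 'I_N))) -(fb_n_comp fb).
  apply: n_comp_eq_in => [a|a _ b]; first by rewrite !inE ltn_ord qv.
  by apply: eq_connect; exact: eq_xgraph.
have acy : acyclic (xgraph (fun a => q a)).
  by apply: acyclic_sub (fb_acyclic fb) => a b; rewrite (eq_xgraph qv).
have key p : (p \in forest_involutions M N v) = (p == q) && (c == M).
  rewrite inE; apply/and3P/andP => [[_ /forallP ag]|[/eqP-> cM]].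
    have -> : p = q by apply/ffunP => a; apply: val_inj; rewrite /= qv -(eqP (ag a)) prN.
    by rewrite acy conn eqxx.
  rewrite conn acy cM; split=> //; apply/forallP => a.
  by rewrite prN qv.
case: (c =P M) => cM.
  by rewrite -[RHS](cards1 q); apply: eq_card => p; rewrite key inE cM eqxx andbT.
by apply: eq_card0 => p; rewrite key (introF eqP cM) andbF.
Qed.

Lemma card_forest_involutions M d t v bl c : t + d = N -> scan_state t v bl c ->
  #|forest_involutions M t v| = num_paths M d c [seq size B | B <- bl].
Proof.
elim: d t v bl c => [|d IH] t v bl c.
  rewrite addn0 => -> ss; rewrite (card_scan_end M ss).
  by case: bl {ss}.
move=> tN ss; have tlt : t < N by lia.
pose x := Ordinal tlt; have [pv ne so me fb] := ss.
rewrite -[t]/(x : nat) in ss pv me fb *.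
rewrite /forest_involutions (card_agree_step _ pv (fb_uniq fb) me) /=; congr (_ + _).
  by apply: (IH x.+1 _ ([:: x] :: bl)); [rewrite /=; lia|exact: scan_open].
apply: sum_closings_blocks => //; last exact: fb_uniq fb.
- move=> s1 a s2 y z fl ys zs yz sb; apply: eq_card0 => p; rewrite !inE.
  apply/negP => /and3P[_ ag /andP[acy _]].
  by have := scan_cyclic ss fl ys zs yz sb ag; rewrite acy.
move=> acc a b rest eb; rewrite eb in ss.
have := IH x.+1 _ _ _ _ (scan_close ss).
rewrite addSnnS => /(_ tN); rewrite /forest_involutions => ->.
rewrite -size_cat; by case: (acc ++ b).
Qed.

Lemma card_forest_involutions_all M :
  #|[set p | [&& fpf_involution p, acyclic (xgraph (fun a => p a))
    & n_comp (xgraph (fun a => p a)) [pred a : 'I_N | a < p a] == M]]| = num_paths M N 0 [::].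
Proof.
rewrite -(card_forest_involutions M (add0n N) scan_start).
apply: eq_card => p; rewrite !inE; congr andb.
suff -> : agree p 0 (fun a => a) by [].
by apply/forallP.
Qed.

End Scan.

(** * Chord diagrams as involutions *)

Section Chords.
Variable N : nat.
Implicit Types (p q : {ffun 'I_N -> 'I_N}) (x y : 'I_N) (A B : {set 'I_N}).

Definition chord p x := [set x; p x].
Definition chords p := [set chord p x | x : 'I_N].

Lemma fpf_involutionP p :
  reflect (involutive p /\ forall x, p x != x) (fpf_involution p).
Proof.
apply: (iffP forallP) => [fp|[pK nf] x]; last by rewrite pK eqxx nf.
by split=> x; case/andP: (fp x) => // /eqP.
Qed.

Section Involution.
Variable p : {ffun 'I_N -> 'I_N}.
Hypothesis fp : fpf_involution p.

Let pK : involutive p. Proof. by case/fpf_involutionP: fp. Qed.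
Let pN x : p x != x. Proof. by case/fpf_involutionP: fp. Qed.

Lemma chord_mem x : chord p x \in chords p.
Proof. exact: imset_f. Qed.

Lemma chord_in x y : y \in chord p x -> chord p y = chord p x.
Proof. by rewrite !inE => /orP[]/eqP-> //; rewrite /chord pK setUC. Qed.

Lemma chords_partition : partition (chords p) [set: 'I_N].
Proof.
apply/and3P; split.
- apply/eqP/setP => x; rewrite inE; apply/bigcupP.
  by exists (chord p x); rewrite ?imset_f // !inE eqxx.
- apply/trivIsetP => _ _ /imsetP[x _ ->] /imsetP[y _ ->] xy.
  rewrite -setI_eq0; apply: contraNT xy => /set0Pn[z]; rewrite inE.
  by case/andP=> /chord_in <- /chord_in <-.
- by apply/imsetP => -[x _ /setP/(_ x)]; rewrite !inE eqxx.
Qed.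

Lemma card_chords A : A \in chords p -> #|A| == 2.
Proof. by case/imsetP=> x _ ->; rewrite cards2 (eq_sym x) pN. Qed.

Lemma xgraph_openers x y :
  xgraph (fun a => p a) x y -> (x < p x) && (y < p y).
Proof. by rewrite /xgraph; lia. Qed.

Lemma set2_ord (a c x y : 'I_N) : a < c -> x < y -> [set a; c] = [set x; y] ->
  a = x /\ c = y.
Proof.
move=> ac xy e.
have: a \in [set x; y] by rewrite -e !inE eqxx.
have: c \in [set x; y] by rewrite -e !inE eqxx orbT.
rewrite !inE => /orP[]/eqP ec /orP[]/eqP ea; split=> //; subst; lia.
Qed.

Lemma cross_chord x y : x < p x -> y < p y ->
  cross (chord p x) (chord p y) = xgraph (fun a => p a) x y.
Proof.
move=> xp yp; apply/idP/idP.
  case/existsP=> a /existsP[b /existsP[c /existsP[d /and3P[/eqP eA /eqP eB h]]]].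
  have ac : a < c by lia.
  have bd : b < d by lia.
  have [ea ec] := set2_ord xp ac eA; have [eb ed] := set2_ord yp bd eB.
  by move: h; rewrite -ea -ec -eb -ed.
move=> h; apply/existsP; exists x; apply/existsP; exists y.
by apply/existsP; exists (p x); apply/existsP; exists (p y); rewrite !eqxx.
Qed.

(* The default d serves for sets that are not chords.                          *)
Definition opener (d : 'I_N) A := odflt d [pick x in A | (x < p x) && (A == chord p x)].

Lemma openerK d A : A \in chords p -> (opener d A < p (opener d A)) /\ chord p (opener d A) = A.
Proof.
case/imsetP=> x _ eA; rewrite /opener; case: pickP => [y /and3P[_ yp /eqP <-] //|].
have [xp|px] := ltnP x (p x).
  by move/(_ x); rewrite eA xp eqxx !inE eqxx.
have {}px : p x < x by have := pN x; rewrite -val_eqE /=; lia.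
move/(_ (p x)); rewrite eA pK px !inE eqxx orbT /=.
by rewrite (@chord_in x (p x)) ?eqxx // !inE eqxx orbT.
Qed.

Lemma chordK d x : x < p x -> opener d (chord p x) = x.
Proof.
move=> xp; have [oo co] := openerK d (chord_mem x).
by case: (set2_ord oo xp co).
Qed.

Lemma acyclic_chords :
  acyclic (intersection_graph (chords p)) = acyclic (xgraph (fun a => p a)).
Proof.
(* A vertex of a cycle lies on an edge, so it is an opener, respectively a chord of the diagram;
   there [chord p] and [opener] are mutually inverse. *)
have all_cycle (T : finType) (e : rel T) (P : pred T) (s : seq T) :
    (forall u w, e u w -> P u) -> cycle e s -> all P s.
  by move=> eP cs; apply/allP => x /(next_cycle cs)/eP.
apply/acyclicP/acyclicP => acy s /andP[cs us].
  have os : all (fun x => x < p x) s.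
    by apply: all_cycle cs => x y /xgraph_openers/andP[].
  rewrite -(size_map (chord p)); apply: acy; apply/andP; split.
    apply: (homo_cycle_in (P := fun x => x < p x)) os cs => x y xp yp.
    by rewrite /intersection_graph /= !chord_mem cross_chord.
  rewrite map_inj_in_uniq // => x y /(allP os) xp /(allP os) yp /(congr1 (opener x)).
  by rewrite !chordK.
case: s cs us => // A s cs us.
have os : all [in chords p] (A :: s).
  by apply: all_cycle cs => B C /and3P[].
have [x _ _] := imsetP (allP os A (mem_head A s)).
rewrite -(size_map (opener x)); apply: acy; apply/andP; split.
  apply: (homo_cycle_in (P := [in chords p])) os cs => B C Bp Cp /and3P[_ _].
  have [oB eB] := openerK x Bp; have [oC eC] := openerK x Cp.
  by rewrite -cross_chord // eB eC.
rewrite map_inj_in_uniq // => B C /(allP os) Bp /(allP os) Cp /(congr1 (chord p)).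
by rewrite (openerK x Bp).2 (openerK x Cp).2.
Qed.

Lemma num_components_chords :
  num_components (chords p) = n_comp (xgraph (fun a => p a)) [pred a : 'I_N | a < p a].
Proof.
rewrite /num_components.
case: (pickP (@predT 'I_N)) => [x0 _|no]; last first.
  rewrite [RHS]eq_card0; last by move=> x; have := no x.
  apply: eq_card0 => A; rewrite !inE; apply/negP => /andP[_ /imsetP[x]].
  by have := no x.
(* The default is a closing point, so that [opener d A] is an opener exactly when [A] is a chord;
   the adjunction then compares the right vertex sets. *)
have [d dp] : exists d, p d < d.
  have [?|?] := ltnP (p x0) x0; first by exists x0.
  exists (p x0); rewrite pK; have := pN x0; rewrite -val_eqE /=; lia.
have sx := sym_connect_sym (xgraph_sym (fun a => p a)).
have si := intersection_graph_connect_sym (chords p).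
have clx : closed (xgraph (fun a => p a)) [pred a : 'I_N | a < p a].
  by move=> x y /xgraph_openers/andP[xp yp]; rewrite !inE xp yp.
have oin A : (opener d A < p (opener d A)) = (A \in chords p).
  apply/idP/idP => [|/openerK-/(_ d)[]//].
  rewrite /opener; case: pickP => [x /and3P[_ _ /eqP->] _|_ /=]; first exact: chord_mem.
  by move=> h; have := ltn_trans h dp; rewrite ltnn.
rewrite (adjunction_n_comp (opener d) sx si clx); last first.
  apply: (intro_adjunction si clx (fun x _ => chord p x)) => [x xp|A Ap].
    rewrite chordK //; split=> // y yp xy; apply: connect1.
    by rewrite /intersection_graph /= !chord_mem cross_chord.
  have {}Ap : A \in chords p by rewrite -oin.
  have [oA eA] := openerK d Ap; split; first by rewrite eA.
  move=> B /and3P[_ Bp]; have [oB eB] := openerK d Bp.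
  by rewrite -{1}eA -{1}eB cross_chord // => /connect1.
by apply: eq_n_comp_r => A; rewrite !inE oin.
Qed.

End Involution.

Lemma chords_inj : {in @fpf_involution N &, injective chords}.
Proof.
move=> p q fp fq e; apply/ffunP => x.
have : chord p x \in chords q by rewrite -e chord_mem.
case/imsetP=> y _ ey; have xy : x \in chord q y by rewrite -ey !inE eqxx.
have : p x \in chord q x by rewrite (chord_in fq xy) -ey !inE eqxx orbT.
case/fpf_involutionP: fp => _ /(_ x) /negPf h; by rewrite !inE h => /eqP.
Qed.

Lemma chords_surj (C : {set {set 'I_N}}) : partition C [set: 'I_N] ->
  (forall A, A \in C -> #|A| == 2) -> exists2 p, fpf_involution p & C = chords p.
Proof.
case/and3P=> /eqP cov tri _ c2.
pose b := pblock C.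
have xb x : x \in b x by rewrite mem_pblock cov.
have bC x : b x \in C by rewrite pblock_mem // cov.
have ex x : {y | b x == [set x; y] & y != x}.
  apply: sig2W; have /cards2P[y [z [yz e]]] := c2 _ (bC x).
  have := xb x; rewrite e !inE => /orP[]/eqP ->; first by exists z; rewrite // eq_sym.
  by exists y => //; rewrite setUC.
pose p := [ffun x => s2val (ex x)].
have bE x : b x = chord p x by rewrite /chord ffunE; apply/eqP; case: (ex x).
have pN x : p x != x by rewrite ffunE; case: (ex x).
have pK : involutive p.
  move=> x; have pxb : p x \in b x by rewrite bE !inE eqxx orbT.
  have := xb x; rewrite {1}/b -(same_pblock tri pxb) -/(b (p x)) bE !inE.
  by rewrite eq_sym (negPf (pN x)) => /eqP.
exists p; first by apply/fpf_involutionP.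
apply/setP => A; apply/idP/imsetP => [AC|[x _ ->]]; last by rewrite -bE.
have /set0Pn[x xA] : A != set0 by rewrite -card_gt0 (eqP (c2 _ AC)).
by exists x => //; rewrite -bE /b (def_pblock tri AC xA).
Qed.

End Chords.

Lemma num_forest_diagrams_paths (n m : nat) :
  num_forest_diagrams n m = num_paths m (2 * n) 0 [::].
Proof.
rewrite -card_forest_involutions_all /num_forest_diagrams.
rewrite -[RHS](card_in_imset (f := @chords (2 * n))); last first.
  by move=> p q; rewrite !inE => /and3P[fp _ _] /and3P[fq _ _]; apply: chords_inj.
apply: eq_card => C; rewrite inE; apply/andP/imsetP => [[/andP[/andP[par /forall_inP c2]]]|].
  have [p fp ->] := chords_surj par c2.
  rewrite acyclic_chords // num_components_chords // => acy nc.
  by exists p => //; rewrite inE fp acy nc.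
case=> p; rewrite inE => /and3P[fp acy nc] ->.
rewrite num_components_chords // nc /forest_chord_diagram acyclic_chords // acy andbT.
rewrite /chord_diagram chords_partition //; split=> //.
by apply/forall_inP => A; apply: card_chords.
Qed.

(** * Counting paths *)

Local Open Scope ring_scope.

Ltac natr_neq0 :=
  rewrite ?(nat1r, natr1, =^~ natrM, =^~ natrD, pnatr_eq0); lia.

(* The power series F and B are given by F = 1 + u x^2 F^2 B and               *)
(* B = 1 + x^2 F^2 B^3; FB_coef r s k m is the coefficient of x^(2(k+m)) u^m   *)
(* in F^r B^s, as obtained by Lagrange inversion. Only the two linear          *)
(* recurrences given by these equations are needed.                            *)
Definition FB_coef (r s k m : nat) : rat :=
  if (k + m == 0)%N then 1 else
  'C(2 * (k + m) + r, m)%:R / (2 * (k + m) + r)%N%:R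
  * ((r * (m + s) + 2 * s * k)%N%:R / (3 * k + m + s)%N%:R)
  * 'C(3 * k + m + s, k)%:R.

Lemma binS_diag_rat (p k : nat) :
  'C(p.+1, k.+1)%:R = p.+1%:R * 'C(p, k)%:R / k.+1%:R :> rat.
Proof.
have nz : k.+1%:R != 0 :> rat by rewrite pnatr_eq0.
by apply: (mulIf nz); rewrite divfK // -!natrM mul_bin_diag mulnC.
Qed.

(** In the variables y = u x^2 and z = x^2, setting y = 0 gives F = 1. *)
Lemma FB_coef_u0 r s k : FB_coef r.+1 s k 0 = FB_coef r s k 0.
Proof.
rewrite /FB_coef addn0; case: k => [|k] //=.
rewrite !bin0 !addn0 !add0n; congr (_ * _).
field.
by natr_neq0.
Qed.

Lemma FB_coef_rel_F r s k m :
  FB_coef r.+1 s k m.+1 = FB_coef r s k m.+1 + FB_coef r.+2 s.+1 k m.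
Proof.
rewrite /FB_coef addnS /=.
have -> : (2 * (k + m).+1 + r.+1 = (2 * (k + m) + r).+3)%N by lia.
have -> : (2 * (k + m).+1 + r = (2 * (k + m) + r).+2)%N by lia.
have -> : (2 * (k + m) + r.+2 = (2 * (k + m) + r).+2)%N by lia.
rewrite binS_diag_rat.
(* Pascal's rule and absorption reduce every binomial on this side to one common factor, leaving a
   rational identity. *)
have E : 'C((2 * (k + m) + r).+2, m.+1)%:R =
  ((2 * (k + m) + r).+3)%:R * 'C((2 * (k + m) + r).+2, m)%:R / m.+1%:R
   - 'C((2 * (k + m) + r).+2, m)%:R :> rat.
  by rewrite -binS_diag_rat [in RHS]binS natrD addrK.
rewrite E.
have -> : (3 * k + m + s.+1 = 3 * k + m.+1 + s)%N by lia.
case: eqP => [/eqP|_].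
  rewrite addn_eq0 => /andP[/eqP-> /eqP->]; rewrite !bin0.
  by field; natr_neq0.
field.
by natr_neq0.
Qed.

(** In the variables y = u x^2 and z = x^2, setting z = 0 gives B = 1. *)
Lemma FB_coef_k0 r s m : FB_coef r s.+1 0 m = FB_coef r s 0 m.
Proof.
rewrite /FB_coef add0n; case: m => [|m] //=.
rewrite !bin0 !muln0 !addn0 ?add0n; congr (_ * _).
congr (_ * _); field.
by natr_neq0.
Qed.

Lemma FB_coef_rel_B r s k m :
  FB_coef r s.+1 k.+1 m = FB_coef r s k.+1 m + FB_coef r.+2 s.+3 k m.
Proof.
rewrite /FB_coef addSn /=.
have -> : (2 * (k + m).+1 + r = 2 * (k + m) + r.+2)%N by lia.
have -> : (3 * k.+1 + m + s.+1 = (3 * k + m + s.+3).+1)%N by lia.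
have -> : (3 * k.+1 + m + s = 3 * k + m + s.+3)%N by lia.
have E : 'C(3 * k + m + s.+3, k.+1)%:R =
  ((3 * k + m + s.+3).+1)%:R * 'C(3 * k + m + s.+3, k)%:R / k.+1%:R
   - 'C(3 * k + m + s.+3, k)%:R :> rat.
  by rewrite -binS_diag_rat [in RHS]binS natrD addrK.
rewrite E binS_diag_rat.
case: eqP => [/eqP|_].
  rewrite addn_eq0 => /andP[/eqP-> /eqP->]; rewrite !bin0.
  by field; natr_neq0.
field.
by natr_neq0.
Qed.

(* The coefficient of x^T u^M in x^i u^j F^r B^s.                              *)
Definition FB_coef_at (T M r s i j : nat) : rat :=
  if [&& i <= T, j <= M, ~~ odd (T - i) & M - j <= (T - i)./2]%N
  then FB_coef r s ((T - i)./2 - (M - j)) (M - j) else 0.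

Variant FB_coef_at_spec T M r s i j : rat -> Type :=
| FB_in k m of (T = i + 2 * (k + m))%N & (M = j + m)%N :
    FB_coef_at_spec T M r s i j (FB_coef r s k m)
| FB_out of (forall k m, ~ (T = i + 2 * (k + m) /\ M = j + m)%N) :
    FB_coef_at_spec T M r s i j 0.

Lemma FB_coef_atP T M r s i j :
  FB_coef_at_spec T M r s i j (FB_coef_at T M r s i j).
Proof.
rewrite /FB_coef_at; case: ifP => [/and4P[iT jM odT le]|H].
  by apply: FB_in; lia.
by apply: FB_out => k m [eT eM]; move/negP: H; apply; apply/and4P; split; lia.
Qed.

Lemma FB_coef_at_in T M r s i j k m : (T = i + 2 * (k + m))%N -> (M = j + m)%N ->
  FB_coef_at T M r s i j = FB_coef r s k m.
Proof.
move=> eT eM; case: FB_coef_atP => [k' m' eT' eM'|H]; last by case: (H k m).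
by congr FB_coef; lia.
Qed.

Lemma FB_coef_at_rel_F T M r s i j :
  FB_coef_at T M r.+1 s i j = FB_coef_at T M r s i j + FB_coef_at T M r.+2 s.+1 i.+2 j.+1.
Proof.
case: (FB_coef_atP T M r.+1 s) => [k [|m] eT eM|H].
- rewrite (@FB_coef_at_in _ _ _ _ _ _ k 0) // FB_coef_u0.
  by case: FB_coef_atP => [k' m' ? ?|_]; [lia|rewrite addr0].
- rewrite (@FB_coef_at_in _ _ _ _ _ _ k m.+1) // (@FB_coef_at_in _ _ _ _ _ _ k m); try lia.
  exact: FB_coef_rel_F.
case: FB_coef_atP => [k' m' ? ?|_]; first by case: (H k' m').
case: FB_coef_atP => [k' m' ? ?|_]; first by case: (H k' m'.+1); lia.
by rewrite addr0.
Qed.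

Lemma FB_coef_at_rel_B T M r s i j :
  FB_coef_at T M r s.+1 i j = FB_coef_at T M r s i j + FB_coef_at T M r.+2 s.+3 i.+2 j.
Proof.
case: (FB_coef_atP T M r s.+1) => [[|k] m eT eM|H].
- rewrite (@FB_coef_at_in _ _ _ _ _ _ 0 m) // FB_coef_k0.
  by case: FB_coef_atP => [k' m' ? ?|_]; [lia|rewrite addr0].
- rewrite (@FB_coef_at_in _ _ _ _ _ _ k.+1 m) // (@FB_coef_at_in _ _ _ _ _ _ k m); try lia.
  exact: FB_coef_rel_B.
case: FB_coef_atP => [k' m' ? ?|_]; first by case: (H k' m').
case: FB_coef_atP => [k' m' ? ?|_]; first by case: (H k'.+1 m'); lia.
by rewrite addr0.
Qed.

Lemma FB_coef_at_gt T M r s i j : (T < i)%N -> FB_coef_at T M r s i j = 0.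
Proof. by move=> lt; case: FB_coef_atP => // k m; lia. Qed.

Lemma FB_coef_at00 T M i j : FB_coef_at T M 0 0 i j = ((i == T) && (j == M))%:R.
Proof.
case: FB_coef_atP => [k m eT eM|H].
  rewrite /FB_coef !muln0 !addn0 mul0n mul0r mulr0 mul0r.
  by case: eqP => e; case: eqP => e1; case: eqP => e2 //; exfalso; lia.
case: andP => // -[/eqP e1 /eqP e2]; by case: (H 0%N 0%N); lia.
Qed.

(* With x marking points and u components, and P = x F B, the paths from a     *)
(* state st have generating function W(st), where W([]) = F and                *)
(* W(b :: st) = P^b (u W(st) + B S(st)); S(st) is the sum of W over the states *)
(* obtained by closing an open chord of st below one extra singleton. The      *)
(* functions give the coefficient of x^T u^M in x^i u^j F^r B^s W(st) and in   *)
(* x^i u^j F^r B^s S(st).                                                      *)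
Fixpoint path_coefs (T M : nat) (st : seq nat) :
    (nat -> nat -> nat -> nat -> rat) * (nat -> nat -> nat -> nat -> rat) :=
  if st is b :: st' then
    let wS := path_coefs T M st' in
    let w := fun r s i j =>
      wS.1 (r + b)%N (s + b)%N (i + b)%N j.+1 + wS.2 (r + b)%N (s + b).+1 (i + b)%N j in
    (w, fun r s i j => w r s i j + (if b == 1%N then wS.2 r.+1 s.+1 i.+1 j else 0))
  else (fun r s i j => FB_coef_at T M r.+1 s i j, fun r s i j => 0).

(** * Solving the first-step equations *)

(** W and S are sums of monomials in x, u, F and B, so the equation of F may be applied to any
    factor F in front of them. *)
Lemma path_coefs_rel_F T M st r s i j :
  ((path_coefs T M st).1 r.+1 s i j
    = (path_coefs T M st).1 r s i j + (path_coefs T M st).1 r.+2 s.+1 i.+2 j.+1) *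
  ((path_coefs T M st).2 r.+1 s i j
    = (path_coefs T M st).2 r s i j + (path_coefs T M st).2 r.+2 s.+1 i.+2 j.+1).
Proof.
elim: st r s i j => [|b st IH] r s i j /=.
  by rewrite FB_coef_at_rel_F addr0.
rewrite !addSn (IH (r + b)%N (s + b)%N _ _).1 (IH (r + b)%N (s + b).+1 _ _).2.
split; first by ring.
by case: ifP => _; rewrite ?(IH r.+1 s.+1 _ _).2; ring.
Qed.

Lemma path_coefs_rel_B T M st r s i j :
  ((path_coefs T M st).1 r s.+1 i j
    = (path_coefs T M st).1 r s i j + (path_coefs T M st).1 r.+2 s.+3 i.+2 j) *
  ((path_coefs T M st).2 r s.+1 i j
    = (path_coefs T M st).2 r s i j + (path_coefs T M st).2 r.+2 s.+3 i.+2 j).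
Proof.
elim: st r s i j => [|b st IH] r s i j /=.
  by rewrite FB_coef_at_rel_B addr0.
rewrite !addSn (IH (r + b)%N (s + b)%N _ _).1 (IH (r + b)%N (s + b).+1 _ _).2.
split; first by ring.
by case: ifP => _; rewrite ?(IH r.+1 s.+1 _ _).2; ring.
Qed.

Lemma path_coefs_gt T M st r s i j : (T < i)%N ->
  ((path_coefs T M st).1 r s i j = 0) * ((path_coefs T M st).2 r s i j = 0).
Proof.
elim: st r s i j => [|b st IH] r s i j lt /=; first by rewrite FB_coef_at_gt.
by rewrite !IH ?addr0; try lia; case: ifP.
Qed.

(** Each further skipped singleton enlarges the merged block by one, which multiplies W by P. *)
Lemma sum_closings T M k st r s i j : all (leq 1) st ->
  \sum_(x <- closings k.+1 st) (path_coefs T M (x.1 :: x.2)).1 r s i j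
  = (path_coefs T M st).2 (r + k)%N (s + k)%N (i + k)%N j.
Proof.
elim: st k => [|b st IH] k /=; first by rewrite big_nil.
case/andP=> b0 pos; rewrite big_cons /=.
have -> : (k.+1 + b.-1 = k + b)%N by lia.
rewrite !addnA; congr (_ + _).
case: ifP => _; last by rewrite big_nil.
by rewrite IH // !addnS.
Qed.

Lemma closings_pos k st : all (leq 1) st ->
  all (fun x => all (leq 1) (x.1 :: x.2)) (closings k.+1 st).
Proof.
elim: st k => [|b st IH] k //= /andP[b0 pos].
rewrite pos /=.
by case: ifP => // _; apply: IH.
Qed.

Lemma num_paths_coefs T M d c st i : all (leq 1) st -> (i + d = T)%N ->
  (num_paths M d c st)%:R = (path_coefs T M st).1 0%N 0%N i c.
Proof.
elim: d c st i => [|d IH] c st i pos eT.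
  case: st pos => [|b st] /= => [_|/andP[b0 _]].
    have -> : i = T by lia.
    rewrite FB_coef_at_rel_F FB_coef_at00 eqxx /= [X in _ + X]FB_coef_at_gt ?addr0 //; lia.
  by rewrite !path_coefs_gt ?addr0 //; lia.
rewrite /= natrD natr_sum (IH _ _ i.+1) //; last by lia.
case: st pos => [|b st] /=.
  rewrite big_nil !addr0 => _.
  by rewrite (FB_coef_at_rel_F _ _ 0) FB_coef_at00 (_ : (i == T) = false) ?add0r ?addn1 //; lia.
case/andP=> b0 pos; rewrite big_cons /=.
case: b b0 => [|[|b]] // _ /=.
- rewrite (IH _ _ i.+1) //; last by lia.
  rewrite !addn1 ?add0n.
  have -> : \sum_(x <- closings 1 st)
     ((match x.1 with 0%N => num_paths M d c.+1 x.2 | _ => num_paths M d c (x.1 :: x.2) end)%:R : rat)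
   = (path_coefs T M st).2 0%N 0%N i.+1 c.
    have := @sum_closings T M 0 st 0 0 i.+1 c pos; rewrite !addn0 => <-.
    have /allP cl := @closings_pos 0 _ pos.
     rewrite big_seq [RHS]big_seq; apply: eq_bigr => -[x y] /cl.
    by case: x => [|x] // ?; rewrite (IH _ _ i.+1) //; lia.
  set w := (path_coefs T M st).1; set S := (path_coefs T M st).2.
  have rF := path_coefs_rel_F T M st; have rB := path_coefs_rel_B T M st.
  rewrite -/w in rF rB *; rewrite -/S in rF rB *.
  (* Comparing the factors of W(st) and of S(st), this is F B = 1 + x^2 F^2 B^2 (u + B) and F B^2 =
     1 + x^2 F^2 B^3 (u + 1 + B). *)
  rewrite (rF 0%N 1%N i.+1 c.+1).1 (rB 0%N 0%N i.+1 c.+1).1.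
  rewrite (rF 0%N 2%N i.+1 c).2 (rB 0%N 1%N i.+1 c).2 (rB 0%N 0%N i.+1 c).2.
  ring.
rewrite big_nil addr0 (IH _ _ i.+1) //; last by lia.
rewrite ?addn0 ?add0n /= !addSn !addnS !addSn !add0n.
have rF := path_coefs_rel_F T M st; have rB := path_coefs_rel_B T M st.
set w := (path_coefs T M st).1; set S := (path_coefs T M st).2.
rewrite -/w in rF rB *; rewrite -/S in rF rB *.
(* A head block of size at least 2 gives S = W on the whole state; after factoring out the power of
   P, F B = 1 + x^2 F^2 B^2 (u + B) remains. *)
rewrite addn0 (rF b.+1 b.+2 _ c.+1).1 (rB b.+1 b.+1 _ c.+1).1.
rewrite (rF b.+1 b.+3 _ c).2 (rB b.+1 b.+2 _ c).2.
ring.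
Qed.

Lemma num_paths_nil n m : (0 < n)%N -> (0 < m)%N -> (m <= n)%N ->
  (num_paths m (2 * n) 0 [::])%:R =
    if (m <= n - 1)%N then
      1 / (n - m)%N%:R * 'C(2 * n, m - 1)%:R
        * 'C(3 * n - 2 * m - 1, n - m - 1)%:R
    else 1 / (n + 1)%N%:R * 'C(2 * n, n)%:R :> rat.
Proof.
move=> n0 m0 mn; rewrite (@num_paths_coefs (2 * n) _ _ _ _ 0) //=.
(* W([]) is F itself, so the exponents are r = 1 and s = 0, and the power x^(2n) leaves k = n -
   m. *)
rewrite (@FB_coef_at_in _ _ _ _ _ _ (n - m) m); try lia.
rewrite /FB_coef; case: eqP => [|_]; first by lia.
have -> : (n - m + m = n)%N by lia.
case: m m0 mn => // m _ mn.
rewrite addn1 binS_diag_rat subSS subn0 !muln0 mul0n !addn0 mul1n.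
case: ifP => le.
  have [k ->] : exists k, (n = m.+1 + k.+1)%N by exists (n - m.+2)%N; lia.
  have -> : (m.+1 + k.+1 - m.+1 = k.+1)%N by lia.
  have -> : (3 * k.+1 + m.+1 = (3 * k + m.+3).+1)%N by lia.
  have -> : (3 * (m.+1 + k.+1) - 2 * m.+1 - 1 = 3 * k + m.+3)%N by lia.
  rewrite subn1 /= binS_diag_rat; field.
  by natr_neq0.
have -> : n = m.+1 by lia.
rewrite subnn bin0 muln0 add0n.
have -> : 'C(2 * m.+1, m.+1)%:R =
  (2 * m.+1).+1%:R * 'C(2 * m.+1, m)%:R / m.+1%:R - 'C(2 * m.+1, m)%:R :> rat.
  by rewrite -binS_diag_rat [in RHS]binS natrD addrK.
field.
by natr_neq0.
Qed.

Theorem theorem1 (n m : nat) (hn : (0 < n)%N) (hm : (0 < m)%N)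
    (hmn : (m <= n)%N) :
  (num_forest_diagrams n m)%:R =
    if (m <= n - 1)%N then
      1 / (n - m)%N%:R * 'C(2 * n, m - 1)%:R
        * 'C(3 * n - 2 * m - 1, n - m - 1)%:R
    else 1 / (n + 1)%N%:R * 'C(2 * n, n)%:R :> rat.
Proof. by rewrite num_forest_diagrams_paths num_paths_nil. Qed.
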